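(* Let $p$ be a prime and $n,k$ positive integers with $k<n$. There exists a classical deterministic algorithm that solves the generalized Simon's problem $\mathsf{GSP}(p,n,k)$ using $O\left(\max\{k,\sqrt{k\cdot p^{n-k}}\}\right)$ queries to $f$.
   Context: $\mathbb{Z}_p^n$ is the additive group of $n$-tuples over $\mathbb{Z}_p$ with componentwise addition mod $p$; its subgroups are exactly the $\mathbb{F}_p$-linear subspaces, and the rank of a subgroup is its dimension. The problem $\mathsf{GSP}(p,n,k)$: one is given oracle access to an unknown function $f:\mathbb{Z}_p^n\to X$, where $X$ is a finite set, with the promise that there is a subgroup $S\le\mathbb{Z}_p^n$ of rank $k$ such that for all $x,y\in\mathbb{Z}_p^n$, $f(x)=f(y)$ iff $x-y\in S$; the goal is to output $S$ (with certainty, for a deterministic algorithm). A query returns $f(x)$ for a chosen $x$; the query count is the worst case over all valid $f$. The implied constant in $O$ is absolute. *)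

(* Defs.v *)
From HB Require Import structures.
From mathcomp Require Import all_boot all_order all_fingroup all_algebra.
From mathcomp Require Import reals.

Set Implicit Arguments.
Unset Strict Implicit.
Unset Printing Implicit Defensive.

Import GRing.Theory.
Local Open Scope ring_scope.

(* A classical deterministic query algorithm is an adaptive decision tree: it
   either stops with an output, or queries a point of Q and continues
   according to the answer in X. *)
Inductive query_algorithm (Q X O : Type) : Type :=
| Output of O
| Query of Q & (X -> query_algorithm Q X O).

Fixpoint run (Q X O : Type) (A : query_algorithm Q X O) (f : Q -> X) : O :=
  match A with
  | Output o => o
  | Query q next => run (next (f q)) f
  end.

Fixpoint query_count (Q X O : Type) (A : query_algorithm Q X O) (f : Q -> X)
    : nat :=
  match A with
  | Output _ => 0
  | Query q next => (query_count (next (f q)) f).+1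
  end.

(* {group 'rV['F_p]_n} is the type of subgroups of the additive group of
   'rV['F_p]_n. A subgroup S is an 'F_p-subspace (see span_subgroup), so the
   dimension of the span of its elements is the dimension of S itself. *)
Definition subgroup_rank (p n : nat) (S : {group 'rV['F_p]_n}) : nat :=
  \dim <<enum S>>%VS.

Lemma span_subgroup (p n : nat) (S : {group 'rV['F_p]_n}) (x : 'rV['F_p]_n) :
  (x \in <<enum S>>%VS) = (x \in S).
Proof.
apply/idP/idP => [xS|xS]; last by apply: memv_span; rewrite mem_enum.
have mulS (m : nat) (y : 'rV['F_p]_n) : y \in S -> y *+ m \in S.
  move=> yS; elim: m => [|m IHm]; first by rewrite mulr0n; exact: group1.
  by rewrite mulrS; exact: groupM.
rewrite (coord_span (X := in_tuple (enum S)) xS).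
apply: (big_ind (fun y => y \in S)) => [|y z yS zS|i _].
- exact: group1.
- exact: groupM.
- set c := coord _ _ _; rewrite -[c]natr_Zp scaler_nat; apply: mulS.
  by rewrite -mem_enum mem_nth.
Qed.

Definition hides (p n : nat) (X : finType) (f : 'rV['F_p]_n -> X)
    (S : {group 'rV['F_p]_n}) : Prop :=
  forall x y : 'rV['F_p]_n, f x = f y <-> x - y \in S.

Definition GSP_promise (p n k : nat) (X : finType) (f : 'rV['F_p]_n -> X)
    (S : {group 'rV['F_p]_n}) : Prop :=
  subgroup_rank S = k /\ hides f S.

Definition GSP_algorithm (p n : nat) (X : finType) : Type :=
  query_algorithm 'rV['F_p]_n X {group 'rV['F_p]_n}.

Definition solves_GSP (p n k : nat) (X : finType) (A : GSP_algorithm p n X)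
    : Prop :=
  forall (f : 'rV['F_p]_n -> X) (S : {group 'rV['F_p]_n}),
    GSP_promise k f S -> run A f = S.

Definition worst_case_queries_le (R : realType) (p n k : nat) (X : finType)
    (A : GSP_algorithm p n X) (b : R) : Prop :=
  forall (f : 'rV['F_p]_n -> X) (S : {group 'rV['F_p]_n}),
    GSP_promise k f S -> (query_count A f)%:R <= b.

(* Main.v *)
(* The vectors e of a basis are treated in turn, keeping the queried family U
   independent modulo the hidden subgroup S. If <<U>> = A + B, then e + <<U>>
   meets S if and only if f (e - b) = f a for some a in A and b in B, and such a
   collision yields an element of S; otherwise e joins U. There are k
   collisions, at a cost of |B| each, and U grows n - k times, so taking
   |A| ~ sqrt (k p^|U|) and |B| ~ sqrt (p^|U| / k) gives a geometric sum
   dominated by sqrt (k p^(n-k)); the term k appears because |B| >= 1. *)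

Require Import Defs.
From HB Require Import structures.
From mathcomp Require Import all_boot all_order all_fingroup all_algebra.
From mathcomp Require Import finfield.
From mathcomp Require Import reals.
From mathcomp Require Import zify ring lra.

Set Implicit Arguments.
Unset Strict Implicit.
Unset Printing Implicit Defensive.

Import Order.TTheory GRing.Theory Num.Theory.
Local Open Scope ring_scope.

(** * Non-adaptive batches of queries *)

Section QueryAll.
Variables (Q X O : Type).

(** The continuation receives each point paired with its answer, so that a collision of values can
    be traced back to the vectors. *)
Fixpoint query_all (s : seq Q) (K : seq (Q * X) -> query_algorithm Q X O) :
    query_algorithm Q X O :=
  if s is q :: s' then
    Query q (fun y => query_all s' (fun l => K ((q, y) :: l)))
  else K [::].

Definition answers (f : Q -> X) (s : seq Q) : seq (Q * X) :=
  [seq (q, f q) | q <- s].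

Lemma run_query_all s K f : run (query_all s K) f = run (K (answers f s)) f.
Proof. by elim: s K => [|q s IHs] K //=; rewrite IHs. Qed.

Lemma query_count_query_all s K f :
  query_count (query_all s K) f = (size s + query_count (K (answers f s)) f)%N.
Proof. by elim: s K => [|q s IHs] K //=; rewrite IHs. Qed.

End QueryAll.

(** * Collisions between two lists of answers *)

Section Collision.
Variables (V : zmodType) (X : eqType).

Definition collision (LA LB : seq (V * X)) : option V :=
  if [seq ab <- [seq (a, b) | a <- LA, b <- LB] | ab.1.2 == ab.2.2]
    is ab :: _ then Some (ab.2.1 - ab.1.1) else None.

Variant collision_spec (f : V -> X) (As Bs : seq V) : option V -> Prop :=
| Collision a b of a \in As & b \in Bs & f a = f b :
    collision_spec f As Bs (Some (b - a))
| NoCollision of (forall a b, a \in As -> b \in Bs -> f a <> f b) :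
    collision_spec f As Bs None.

Lemma collisionP f As Bs :
  collision_spec f As Bs (collision (answers f As) (answers f Bs)).
Proof.
rewrite /collision; set P := [seq (a, b) | a <- _, b <- _].
case def_s: (filter _ P) => [|ab s] /=.
- right=> a b aA bB fab.
  suff: ((a, f a), (b, f b)) \in [seq ab <- P | ab.1.2 == ab.2.2].
    by rewrite def_s.
  rewrite mem_filter /=; apply/andP; split; first exact/eqP.
  by apply/allpairsP; exists ((a, f a), (b, f b)); split => //=;
    apply/mapP; [exists a | exists b].
- have: ab \in [seq ab <- P | ab.1.2 == ab.2.2] by rewrite def_s mem_head.
  rewrite mem_filter => /andP[/eqP eq_f /allpairsP[[a b] /= []]].
  move=> /mapP[x xA def_a] /mapP[y yB def_b] def_ab.
  by move: eq_f; rewrite def_ab def_a def_b /= => eq_f; left.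
Qed.

End Collision.

(** * Covering a span by a sumset of two lists with controlled sizes *)

Section SumsetCover.
Variables (p n : nat).
Hypothesis p_pr : prime p.
Local Notation V := 'rV['F_p]_n.

(** The inclusions in [U] let a collision serve as a basis exchange; the covering turns the absence
    of collisions into independence modulo [S]. *)
Definition sumset_cover (A B : seq V) (U : {vspace V}) : Prop :=
  [/\ {subset A <= U}, {subset B <= U} &
      forall x, x \in U -> exists a b, [/\ a \in A, b \in B & x = a + b]].

Lemma Fp_natP (c : 'F_p) : exists2 i, (i < p)%N & c = i%:R.
Proof.
exists (val c); last by rewrite natr_Zp.
by rewrite -[ltnRHS](Fp_cast p_pr) ltn_ord.
Qed.

Lemma card_span_le (U : seq V) : (#|<<U>>%VS| <= p ^ size U)%N.
Proof.
by rewrite card_vspace card_Fp // leq_pexp2l ?prime_gt0 ?dim_span.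
Qed.

(* Splitting one coordinate of U between A and B in base c, and giving the
   coordinates before it to A and the others to B, balances the sizes up to
   a constant even when p is large. *)
Lemma sumset_cover_exists (U : seq V) (s : nat) :
  (0 < s)%N -> (s <= p ^ size U)%N ->
  {AB : seq V * seq V | [/\ sumset_cover AB.1 AB.2 <<U>>%VS,
    (size AB.1 <= s)%N & (size AB.2 * s <= 4 * p ^ size U)%N]}.
Proof.
have p_gt0 := prime_gt0 p_pr.
move=> s_gt0; elim: U => [|e U IHU] /= les.
  exists ([:: 0], [:: 0]); split => //=; last by rewrite expn0 in les *; lia.
  split => [x|x|x]; rewrite ?inE ?span_nil ?memv0 // => /eqP->.
  by exists 0, 0; rewrite !inE addr0.
have eUP x : reflect (exists i u, [/\ (i < p)%N, u \in <<U>>%VS & x = i%:R *: e + u])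
      (x \in <<e :: U>>%VS).
  rewrite span_cons; apply: (iffP memv_addP) => [[_ /vlineP[c ->] [u uU ->]]|].
    by have [i ip ->] := Fp_natP c; exists i, u.
  by case=> i [u [_ uU ->]]; exists (i%:R *: e); [rewrite memvZ ?memv_line | exists u].
have eU_scale i u : u \in <<U>>%VS -> i%:R *: e + u \in <<e :: U>>%VS.
  by move=> uU; rewrite span_cons memv_add ?memvZ ?memv_line.
have [le_s|lt_s] := leqP s (p ^ size U).
- have [[A B] /= [[AU BU cov] leA leB]] := IHU le_s.
  exists (A, [seq i%:R *: e + b | i <- iota 0 p, b <- B]) => /=.
  split=> //; last first.
    by rewrite size_allpairs size_iota expnS -mulnA [leqRHS]mulnCA leq_mul2l leB orbT.
  split=> [x xA|x|x].
  + by rewrite span_cons -[x]add0r memv_add ?mem0v ?AU.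
  + by case/allpairsP=> -[i b] /= [_ /BU bU ->]; apply: eU_scale.
  + case/eUP=> i [u [ip /cov[a [b [aA bB ->]]] ->]].
    exists a, (i%:R *: e + b); split=> //; last by rewrite addrCA.
    by apply/allpairsP; exists (i, b); rewrite mem_iota.
(* Here [e] is the split coordinate: [A] takes its residues below [c] together with all of [<<U>>],
   and [B] takes the multiples of [c]. *)
- pose q := (p ^ size U)%N; pose c := (s %/ q)%N.
  have q_gt0 : (0 < q)%N by rewrite expn_gt0 p_gt0.
  have c_gt0 : (0 < c)%N by rewrite divn_gt0 // ltnW.
  have le_cq : (c * q <= s)%N by apply: leq_divM.
  have lt_cq : (s < c.+1 * q)%N by apply: ltn_ceil.
  have le_cp : (c <= p)%N.
    by rewrite -(leq_pmul2r q_gt0) (leq_trans le_cq) // -expnS.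
  have [d def_d] : {d | d = (p %/ c).+1} by exists (p %/ c).+1.
  exists ([seq i%:R *: e + u | i <- iota 0 c, u <- enum (mem <<U>>%VS)],
          [seq (i * c)%:R *: e | i <- iota 0 d]) => /=.
  rewrite size_allpairs size_map !size_iota -cardE; split; last first.
  + rewrite expnS -/q.
    (* From [s < (c + 1) q <= 2 c q] and [d c <= c + p <= 2 p]: each rounding costs a factor 2,
       hence the 4. *)
    have le_dc : (d * c <= c + p)%N by rewrite def_d mulSn leq_add2l leq_divM.
    have: (d * s <= d * (2 * c * q))%N by rewrite leq_mul2l; nia.
    by move=> /leq_trans; apply; nia.
  + by apply: leq_trans le_cq; rewrite leq_mul2l card_span_le orbT.
  split=> [x|x|x].
  + case/allpairsP=> -[i u] /= [_]; rewrite mem_enum => uU ->.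
    exact: eU_scale.
  + by move=> /mapP[i _ ->]; rewrite -[_ *: _]addr0 eU_scale ?mem0v.
  + case/eUP=> i [u [ip uU ->]].
    exists ((i %% c)%:R *: e + u), ((i %/ c * c)%:R *: e); split.
    * apply/allpairsP; exists ((i %% c)%N, u); split=> //=; last by rewrite mem_enum.
      by rewrite mem_iota /= ltn_mod.
    * apply: (map_f (fun j => (j * c)%:R *: e)).
      by rewrite mem_iota def_d /= ltnS leq_div2r // ltnW.
    * by rewrite {1}(divn_eq i c) natrD scalerDl -addrA addrC.
Qed.

End SumsetCover.

(** * The adaptive search: invariant, correctness and query count *)

Section Search.
Variables (p n : nat) (X : finType).
Local Notation V := 'rV['F_p]_n.
Variables A B : seq V -> seq V.

(* U is a free family whose span meets the hidden subgroup trivially and T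
   consists of elements of it; LA records the answers on A U. *)
Fixpoint search (es U T : seq V) (LA : seq (V * X)) : GSP_algorithm p n X :=
  if es is e :: es' then
    query_all [seq e - b | b <- B U] (fun LB =>
      if collision LA LB is Some t then search es' U (t :: T) LA
      else query_all (A (e :: U)) (search es' (e :: U) T))
  else Output _ _ <<[set x in <<T>>%VS]>>%G.

Hypothesis cover : forall U, sumset_cover (A U) (B U) <<U>>%VS.

Variables (k : nat) (f : V -> X) (S : {group V}).
Hypothesis promise : GSP_promise k f S.
Local Notation W := <<enum S>>%VS.

(** Spanning by exactly [n] vectors makes [U ++ T ++ es] a basis, which is how [T] stays free and at
    most [k] collisions can occur. *)
Record search_inv (es U T : seq V) : Prop := SearchInv {
  inv_full : (<<U>> + <<T>> + <<es>> = fullv)%VS;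
  inv_size : (size U + size T + size es = n)%N;
  inv_free : free U;
  inv_capv : (<<U>> :&: W = 0)%VS;
  inv_sub : (<<T>> <= W)%VS }.

Lemma inv_sizeU es U T : search_inv es U T -> (size U + k <= n)%N.
Proof.
case=> _ _ /eqP <- capUW _; have [<- _] := promise.
have := dimv_sum_cap <<U>> W; rewrite capUW dimv0 addn0 /subgroup_rank => <-.
by rewrite (leq_trans (dimvS (subvf _))) // dimvf /dim /= mul1n.
Qed.

Lemma inv_sizeT es U T : search_inv es U T -> (size T <= k)%N.
Proof.
case=> full sizeE _ _ /dimvS; have [<- _] := promise.
suff /eqP -> : free T by [].
have: free (U ++ T ++ es).
  rewrite /free !span_cat addvA full dimvf !size_cat addnA sizeE.
  by rewrite /dim /= mul1n.
by move=> /catr_free /catl_free.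
Qed.

(** Basis exchange: [e] differs from [e - b - a] by [a + b], which lies in [<<U>>], so the total
    span is unchanged. *)
Lemma inv_found e es U T b a : search_inv (e :: es) U T ->
  a \in A U -> b \in B U -> f a = f (e - b) ->
  search_inv es U (e - b - a :: T).
Proof.
move=> [full sizeE frU capUW subT] aA bB fab.
have [AU BU _] := cover U; have [_ hid] := promise.
split=> //; first 1 last.
- by move: sizeE => /=; lia.
- rewrite span_cons subv_add subT andbT -memvE span_subgroup.
  by apply/hid.
apply/eqP; rewrite eqEsubv subvf -full /=.
set P := (X in (_ <= X)%VS).
have UP : (<<U>> <= P)%VS by rewrite /P -addvA addvSl.
have tTP : (<<e - b - a :: T>> <= P)%VS by rewrite /P [(<<U>> + _)%VS]addvC -addvA addvSl.
have tP : e - b - a \in P by rewrite (subvP tTP) ?memv_span ?mem_head.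
have TP : (<<T>> <= P)%VS.
  by apply: subv_trans tTP; rewrite span_cons addvSr.
have eP : e \in P.
  have -> : e = e - b - a + (a + b) by rewrite addrA !subrK.
  apply: rpredD tP _; apply: (subvP UP).
  by apply: rpredD; [apply: AU | apply: BU].
by rewrite span_cons !subv_add UP TP -memvE eP /= addvSr.
Qed.

(** If [c *: e + u] lay in [W] with [c] nonzero, dividing by [c] and covering [- c^-1 *: u] by
    [a + b] would put [e - b - a] in [S], a collision. *)
Lemma inv_not_found e es U T : search_inv (e :: es) U T ->
  (forall a b, a \in A U -> b \in B U -> f a <> f (e - b)) ->
  search_inv es (e :: U) T.
Proof.
move=> [full sizeE frU capUW subT] neq_f.
have [AU BU cov] := cover U; have [_ hid] := promise.
have notin u c : u \in <<U>>%VS -> c *: e + u \in W -> c = 0.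
  move=> uU cuW; apply/eqP/negPn/negP => c_neq0.
  have [a [b [aA bB def_u]]] : exists a b, [/\ a \in A U, b \in B U &
      - c^-1 *: u = a + b] by apply/cov/memvZ.
  apply: (neq_f a b) => //; apply/esym/hid; rewrite -span_subgroup.
  suff -> : e - b - a = c^-1 *: (c *: e + u) by apply: memvZ.
  rewrite scalerDr scalerA mulVf // scale1r -addrA -opprD [b + a]addrC -def_u.
  by rewrite scaleNr opprK.
split=> //.
- by rewrite -full !span_cons [RHS]addvA; congr (_ + _)%VS; rewrite [RHS]addvC addvA.
- by move: sizeE => /=; lia.
(* If [e] were in [<<U>>], then [0 = 1 *: e + (- e)], a vector of [W], would have a nonzero
   coefficient at [e]. *)
- rewrite free_cons frU andbT; apply/negP => eU.
  have /eqP : (1 : 'F_p) = 0.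
    by apply: (notin (- e)); rewrite ?rpredN // scale1r subrr mem0v.
  by rewrite oner_eq0.
- apply/eqP; rewrite -subv0; apply/subvP=> x; rewrite memv_cap span_cons.
  case/andP=> /memv_addP[_ /vlineP[c ->] [u uU ->]] cuW.
  have c0 := notin _ _ uU cuW; move: cuW; rewrite c0 scale0r add0r => uW.
  by rewrite -capUW memv_cap uU.
Qed.

Lemma run_search es U T : search_inv es U T ->
  run (search es U T (answers f (A U))) f = S.
Proof.
elim: es U T => [|e es IHes] U T inv /=.
  have [full sizeE _ capUW subT] := inv.
  (* With no vector left, [<<U>> + <<T>>] is everything and [U] has at most [n - k] vectors, so
     [<<T>>] has dimension at least [k]. *)
  have defT : (<<T>> = W)%VS.
    apply/eqP; rewrite eqEdim subT /=.
    have [rankS _] := promise; rewrite -/(subgroup_rank S) rankS.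
    rewrite -(leq_add2l (size U)) (leq_trans (inv_sizeU inv)) //.
    have: (n <= \dim <<U>> + \dim <<T>>)%N.
      apply: leq_trans (dimv_add_leqif _ _).
      by rewrite -[(_ + _)%VS]addv0 -span_nil full dimvf /dim /= mul1n.
    by move=> /leq_trans; apply; rewrite leq_add2r dim_span.
  apply/val_inj => /=; rewrite -[RHS]genGid; congr <<_>>%g.
  by apply/setP=> x; rewrite inE defT span_subgroup.
rewrite run_query_all; case: collisionP => [a b0 aA|] /=.
  by case/mapP=> b bB -> fab; apply: IHes; apply: inv_found.
move=> neq_f; rewrite run_query_all; apply: IHes; apply: inv_not_found inv _.
by move=> a b aA bB; apply: neq_f => //; apply: map_f.
Qed.

Variables (R : realDomainType) (c : nat -> R) (d : R).
Hypothesis sizeB : forall U, (size U + k <= n)%N -> (size (B U))%:R <= d.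
Hypothesis sizeBA : forall e U,
  (size (B U) + size (A (e :: U)))%:R <= c (size U).

(** Amortization: a collision is charged [d], a growth of [U] from size [j] is charged [c j], and
    charges already made are added to the queries still to come. Once [es] is empty, exactly [k]
    collisions and [n - k] growths have occurred. *)
Lemma query_count_search es U T : search_inv es U T ->
  (query_count (search es U T (answers f (A U))) f)%:R
    + d *+ size T + \sum_(j < size U) c j
  <= d *+ k + \sum_(j < n - k) c j.
Proof.
have c_ge0 j : 0 <= c j.
  have := sizeBA 0 (nseq j 0); rewrite size_nseq; exact: le_trans.
elim: es U T => [|e es IHes] U T inv /=.
  have leU := inv_sizeU inv; have leT := inv_sizeT inv.
  have [_ /= sizeE _ _ _] := inv.
  have [-> ->] : size T = k /\ size U = (n - k)%N by lia.
  by rewrite add0r.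
rewrite query_count_query_all size_map; case: collisionP => [a b0 aA|] /=.
  case/mapP=> b bB -> fab; apply: le_trans (IHes _ _ (inv_found inv aA bB fab)).
  by have := sizeB (inv_sizeU inv); rewrite natrD /= mulrS; lra.
move=> neq_f; have inv' : search_inv es (e :: U) T.
  apply: inv_not_found inv _ => a b aA bB.
  by apply: neq_f => //; apply: map_f.
apply: le_trans (IHes _ _ inv'); rewrite query_count_query_all big_ord_recr /=.
by have := sizeBA e U; rewrite !natrD; lra.
Qed.

End Search.

(** * Balancing the sizes and summing the costs *)

(** The induction step needs [4 <= 3 x], which holds for [x] the square root of a prime, as 16/9 <
    2. *)
Lemma geometric_sum_le (R : realFieldType) (x : R) (m : nat) :
  4 / 3 <= x -> \sum_(j < m.+1) x ^+ j <= 4 * x ^+ m.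
Proof.
move=> le_x; have x_ge0 : 0 <= x by lra.
elim: m => [|m IHm]; first by rewrite big_ord1 expr0; lra.
rewrite big_ord_recr /= exprS; have := exprn_ge0 m x_ge0.
move: IHm; set S := \sum_(j < _) _; nra.
Qed.

(** Take [s] maximal with [s <= q] and [s ^ 2 <= k q]. If [s = q], then [B] has at most 4 elements;
    otherwise maximality gives [k q <= 4 s ^ 2], and [|B| s <= 4 q] yields the constant 4 * 16 =
    64. *)
Lemma balanced_sumset_cover (p n k : nat) (U : seq 'rV['F_p]_n) :
  prime p -> (0 < k)%N ->
  {AB : seq 'rV['F_p]_n * seq 'rV['F_p]_n | [/\ sumset_cover AB.1 AB.2 <<U>>%VS,
    (size AB.1 ^ 2 <= k * p ^ size U)%N &
    (size AB.2 <= 4)%N || (size AB.2 ^ 2 * k <= 64 * p ^ size U)%N]}.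
Proof.
move=> p_pr k_gt0; set q := (p ^ size U)%N.
have q_gt0 : (0 < q)%N by rewrite expn_gt0 prime_gt0.
pose P s := [&& 0 < s, s <= q & s ^ 2 <= k * q]%N.
have exP : exists s, P s by exists 1%N; rewrite /P q_gt0 exp1n muln_gt0 k_gt0.
have ubP s : P s -> (s <= q)%N by case/and3P.
have [s /and3P[s_gt0 le_sq le_s2] max_s] := ex_maxnP exP ubP.
have [AB [cov leA leB]] := sumset_cover_exists p_pr s_gt0 le_sq.
exists AB; split=> //; first by apply: leq_trans le_s2; rewrite leq_sqr.
move: leB; rewrite -/q; set b := size AB.2 => leB.
have [eq_sq|neq_sq] := eqVneq s q.
  by move: leB; rewrite eq_sq leq_pmul2r // => ->.
have lt_sq : (s < q)%N by rewrite ltn_neqAle neq_sq.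
have lt_kq : (k * q < s.+1 ^ 2)%N.
  rewrite ltnNge; apply/negP => le_kq; have := max_s s.+1.
  by rewrite /P lt_sq le_kq ltnn => /(_ isT).
have le_kq : (k * q <= 4 * s ^ 2)%N.
  apply: leq_trans (ltnW lt_kq) _.
  by rewrite -[4%N]/(2 ^ 2)%N -expnMn leq_sqr; lia.
apply/orP; right; rewrite -(leq_pmul2r q_gt0) -mulnA.
apply: (@leq_trans (b ^ 2 * (4 * s ^ 2))%N); first by rewrite leq_mul2l le_kq orbT.
have : ((b * s) ^ 2 <= (4 * q) ^ 2)%N by rewrite leq_sqr.
by rewrite !expnMn; lia.
Qed.

Theorem theorem3 (R : realType) :
  exists2 C : R, 0 < C &
    forall p n k : nat, prime p -> (0 < k)%N -> (k < n)%N ->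
    forall X : finType, exists A : GSP_algorithm p n X,
      solves_GSP k A /\
      worst_case_queries_le k A
        (C * Num.max k%:R (Num.sqrt (k%:R * p%:R ^+ (n - k)%N))).
Proof.
(* 65 = 1 + 12 + 52: the initial batch, the [k] collisions, and the growths of [U] (13 times the 4
   of the geometric sum). *)
exists 65%:R => [|p n k p_pr k_gt0 lt_kn X]; first by rewrite ltr0n.
pose AB U := balanced_sumset_cover (n := n) U p_pr k_gt0.
pose A U := (sval (AB U)).1; pose B U := (sval (AB U)).2.
have cover U : sumset_cover (A U) (B U) <<U>>%VS by case: (svalP (AB U)).
pose x : R := Num.sqrt p%:R; pose y : R := Num.sqrt k%:R.
have y_ge1 : 1 <= y by rewrite -sqrtr1 ler_wsqrtr // ler1n.
have x_ge43 : 4 / 3 <= x.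
  have : 2 <= p%:R :> R by rewrite ler_nat prime_gt1.
  have := sqr_sqrtr (ler0n R p); rewrite -/x => x2.
  have := sqrtr_ge0 (p%:R : R); rewrite -/x; nra.
have x_ge1 : 1 <= x by lra.
have xn_ge1 j : 1 <= x ^+ j by rewrite exprn_ege1.
have x_sq j : (x ^+ j) ^+ 2 = p%:R ^+ j by rewrite exprAC sqr_sqrtr ?ler0n.
have y_sq : y ^+ 2 = k%:R by rewrite sqr_sqrtr ?ler0n.
have x_gt0 j : 0 < x ^+ j by apply: lt_le_trans (xn_ge1 j).
have y_gt0 : 0 < y by lra.
have leA U : (size (A U))%:R <= y * x ^+ size U.
  case: (svalP (AB U)) => _ leA _.
  rewrite -[_ <= _]ler_sqr ?nnegrE ?ler0n // ?mulr_ge0 ?(ltW (x_gt0 _)) ?(ltW y_gt0) //.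
  by rewrite exprMn x_sq y_sq -!natrX -natrM ler_nat.
have leB U : (size (B U))%:R <= 4 + 8 * x ^+ size U / y.
  case: (svalP (AB U)) => _ _; rewrite -/(B U).
  have q_gt0 : 0 < 8 * x ^+ size U / y by rewrite divr_gt0 // mulr_gt0.
  case/orP=> leB.
    by have : (size (B U))%:R <= 4 :> R; [rewrite ler_nat | lra].
  suff : (size (B U))%:R <= 8 * x ^+ size U / y by lra.
  rewrite ler_pdivlMr // -[_ <= _]ler_sqr ?nnegrE; last 2 first.
  - by rewrite mulr_ge0 // ltW.
  - by rewrite mulr_ge0 // ltW.
  by rewrite !exprMn x_sq y_sq -!natrX -!natrM ler_nat.
pose es : seq 'rV['F_p]_n := vbasis fullv.
have inv (f : 'rV['F_p]_n -> X) S : GSP_promise k f S -> search_inv S es [::] [::].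
  move=> _; split=> //=.
  - by rewrite span_nil !add0v (span_basis (vbasisP _)).
  - by rewrite size_tuple dimvf /dim /= mul1n.
  - exact: nil_free.
  - by rewrite span_nil cap0v.
  - by rewrite span_nil sub0v.
(* [search] expects the answers on [A U] for its current [U], so those for the empty family are
   obtained first. *)
exists (query_all (A [::]) (search A B es [::] [::])); split=> f S promise.
  rewrite run_query_all.
  exact: (run_search (A := A) (B := B) cover promise (inv f S promise)).
have [m def_m] : exists m, (n - k)%N = m.+1 by exists (n - k).-1; lia.
rewrite query_count_query_all natrD.
(* [d] is the cost of [B] at the largest possible size [n - k = m.+1]. In [c], 13 = 4 + 8 + 1: both
   terms of [leB] and the bound [leA] at size [j.+1], whence the extra factor [x]. *)
pose d : R := 4 + 8 * x ^+ m.+1 / y; pose c j : R := 13 * y * x * x ^+ j.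
have sizeB U : (size U + k <= n)%N -> (size (B U))%:R <= d.
  move=> leU; apply: le_trans (leB U) _; rewrite lerD2l ler_pM2r ?invr_gt0; last lra.
  by rewrite ler_pM2l ?ltr0n // ler_weXn2l // -def_m; lia.
have sizeBA e U : (size (B U) + size (A (e :: U)))%:R <= c (size U).
  rewrite natrD; have := leA (e :: U); have := leB U; have := xn_ge1 (size U).
  rewrite /c /= exprS; set z := x ^+ _ => z_ge1.
  have : 8 * z / y <= 8 * z by rewrite ler_pdivrMr; nra.
  have z_le : z <= y * (x * z).
    by rewrite mulrA ler_peMl ?mulr_ege1 //; lra.
  by rewrite -!mulrA; lra.
have := query_count_search (A := A) (B := B) cover promise sizeB sizeBA
  (inv f S promise).
rewrite mulr0n big_ord0 !addr0 def_m -mulr_sumr => le_count.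
have := geometric_sum_le m x_ge43; have := leA [::]; rewrite /= expr0 mulr1.
have -> : Num.sqrt (k%:R * p%:R ^+ m.+1) = y * x ^+ m.+1 :> R.
  by rewrite -y_sq -x_sq -exprMn sqrtr_sqr ger0_norm // ltW // mulr_gt0.
(* Since [k / y = y], the collisions contribute one multiple of each argument of the maximum. *)
have def_dk : d *+ k = 4 * k%:R + 8 * (y * x ^+ m.+1).
  by rewrite -[d *+ k]mulr_natr -y_sq /d; field; rewrite gt_eqF.
set M := Num.max _ _.
have le_kM : k%:R <= M by rewrite le_max lexx.
have : y * x ^+ m.+1 <= M by rewrite le_max lexx orbT.
have : y <= y * x ^+ m.+1 by rewrite ler_peMr // ltW.
move: le_count; rewrite def_dk exprS; set z := x ^+ m; set s := \sum_(_ < _) _.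
move=> le_count le_yM leM le_A le_s.
have : 13 * y * x * s <= 13 * y * x * (4 * z).
  by rewrite ler_wpM2l // !mulr_ge0; lra.
lra.
Qed.
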